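(* Let $K=\mathbb{C}(x_1,\dots,x_n)$, let $\Omega\neq 0$ be an $(n-1)$-form over $K$, let $L$ be a finite Galois extension of $K$ with group $G=Gal(L:K)$, and let $\omega\in\mathcal{I}(\Omega)$, with images under $G$ organized in blocks $\mathcal{B}_1,\dots,\mathcal{B}_r$ with spans $V_1,\dots,V_r$ of dimension $s$ over $L$ and common closed forms $\alpha_1,\dots,\alpha_r$, as described in the context. Assume that $s>1$ and that $\Omega$ admits no rational first integral. Then for every $\sigma\in G$ the matrix $A(\sigma)\in GL(rs,L)$ that represents its action on the basis $\omega_{1,1},\dots,\omega_{1,s},\dots,\omega_{r,1},\dots,\omega_{r,s}$ actually has all entries in $\mathbb{C}$.
   Context: $L'$ denotes the $L$-vector space of one-forms $\sum_i a_i\,dx_i$ with $a_i\in L$ (derivations extend uniquely to $L$; $G$ acts on forms coefficientwise and commutes with $d$). $\mathcal{I}(\Omega)$ is the set of all $0\neq\omega\in L'$ for which there is $\alpha\in L'$ with $\omega\wedge\Omega=0$, $d\omega=\alpha\wedge\omega$, $d\alpha=0$. A rational first integral of $\Omega$ is a non-constant $\phi\in K$ with $d\phi\wedge\Omega=0$. Block setting: the set of distinct images of $\omega=\omega_{1,1}$ under $G$ is partitioned into blocks $\mathcal{B}_k=\{\omega_{k,1},\dots,\omega_{k,q}\}$, $1\le k\le r$, which are the images of $\mathcal{B}_1$ under the action of $G$ (so $G$ permutes the blocks). $V_k=\langle\mathcal{B}_k\rangle_L$ has dimension $s$ over $L$, with $L$-basis $\omega_{k,1},\dots,\omega_{k,s}$,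 and the span $V$ of all images is the direct sum $V=V_1\oplus\dots\oplus V_r$, with $rs\le n-1$. Let $G_1=\{\sigma\in G:\ \sigma(\mathcal{B}_k)=\mathcal{B}_k,\ 1\le k\le r\}$, with fixed field $M$. For each $k$ there is a closed form $\alpha_k\in M'$ such that $d\omega_{k,j}=\alpha_k\wedge\omega_{k,j}$ for all $\omega_{k,j}\in\mathcal{B}_k$. (When $\mathcal{I}(\Omega)$ contains a closed form $\omega$, one takes a single block consisting of all images of $\omega$, and $\alpha_1=0$.) The matrix $A(\sigma)$ is the matrix of coefficients expressing the forms $\sigma(\omega_{k,i})$, $1\le k\le r$, $1\le i\le s$, in terms of this basis of $V$. *)

(* Defs.v *)
From HB Require Import structures.
From mathcomp Require Import all_boot all_order all_algebra all_fingroup all_field.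
From mathcomp Require Import generic_quotient reals complex.
From mathcomp Require Import mpoly.

Set Implicit Arguments.
Unset Strict Implicit.
Unset Printing Implicit Defensive.

Import Order.TTheory GRing.Theory Num.Theory.
Local Open Scope ring_scope.
Local Open Scope quotient_scope.

(** * The exterior algebra in dx_0, ..., dx_(n-1) over a commutative ring

    [eta S] is the coefficient of dx_(i_1) /\ ... /\ dx_(i_p), where
    i_1 < ... < i_p are the elements of [S]. *)
Definition diff_form (F : comNzRingType) (n : nat) : Type :=
  {ffun {set 'I_n} -> F}.

Definition homogeneous (F : comNzRingType) (n p : nat) (eta : diff_form F n) : Prop :=
  forall S : {set 'I_n}, #|S| != p -> eta S = 0.

(** For disjoint [A] and [B], dx_A /\ dx_B = wedge_sign A B dx_(A :|: B): the
    exponent counts the inversions of the concatenation of [A] and [B]. *)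
Definition wedge_sign (F : comNzRingType) (n : nat) (A B : {set 'I_n}) : F :=
  (-1) ^+ #|[set p in setX A B | (p.2 < p.1)%N]|.

Definition wedge (F : comNzRingType) (n : nat) (eta theta : diff_form F n) :
    diff_form F n :=
  [ffun S : {set 'I_n} => \sum_(A : {set 'I_n} | A \subset S)
     wedge_sign F A (S :\: A) * eta A * theta (S :\: A)].

(** The exterior derivative, [D i] being the derivation d/dx_i of [F]. *)
Definition ext_d (F : comNzRingType) (n : nat) (D : 'I_n -> F -> F)
    (eta : diff_form F n) : diff_form F n :=
  [ffun S : {set 'I_n} => \sum_(i in S)
     wedge_sign F [set i] (S :\ i) * D i (eta (S :\ i))].

Definition form0 (F : comNzRingType) (n : nat) (f : F) : diff_form F n :=
  [ffun S : {set 'I_n} => if S == set0 then f else 0].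

(** One-forms are row vectors [a], standing for the sum of the a_i dx_i, so that
    they make up a [vectType]; [form1] embeds them in the exterior algebra. *)
Definition form1 (F : comNzRingType) (n : nat) (a : 'rV[F]_n) : diff_form F n :=
  [ffun S : {set 'I_n} => \sum_(i | S == [set i]) a 0 i].

Definition map_form (F F' : comNzRingType) (n : nat) (f : F -> F')
    (eta : diff_form F n) : diff_form F' n :=
  [ffun S : {set 'I_n} => f (eta S)].

(** * The field C(x_0, ..., x_(n-1)) and its partial derivatives *)
Definition ratfun (R : realType) (n : nat) : fieldType :=
  {fraction {mpoly R[i][n]}}.

Definition ratfun_const (R : realType) (n : nat) (c : R[i]) : ratfun R n :=
  tofrac (mpolyC n c).

(** The quotient rule, applied to the canonical representative p / q of [f]. *)
Definition partial (R : realType) (n : nat) (i : 'I_n) (f : ratfun R n) :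
    ratfun R n :=
  let p := \n_(repr f) in let q := \d_(repr f) in
  tofrac (mderiv i p * q - p * mderiv i q) / tofrac (q ^+ 2).

(** The derivations [D i] extend the d/dx_i to [L]; for finite [L] there is
    exactly one such family. *)
Record extends_partial (R : realType) (n : nat) (L : fieldExtType (ratfun R n))
    (D : 'I_n -> L -> L) : Prop := ExtendsPartial {
  derivD : forall i, {morph D i : a b / a + b};
  derivM : forall i a b, D i (a * b) = D i a * b + a * D i b;
  deriv_base : forall i (f : ratfun R n), D i f%:A = (partial i f)%:A
}.

Definition rational_first_integral (R : realType) (n : nat)
    (Omega : diff_form (ratfun R n) n) (phi : ratfun R n) : Prop :=
  ~ (exists c : R[i], phi = ratfun_const n c) /\
  wedge (ext_d (@partial R n) (form0 n phi)) Omega = 0.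

(** [inI Omega D omega] is the membership of [omega] in I(Omega). *)
Definition inI (R : realType) (n : nat) (L : fieldExtType (ratfun R n))
    (Omega : diff_form (ratfun R n) n) (D : 'I_n -> L -> L) (omega : 'rV[L]_n) :
    Prop :=
  omega != 0 /\
  exists alpha : 'rV[L]_n,
    [/\ wedge (form1 omega) (map_form (in_alg L) Omega) = 0,
        ext_d D (form1 omega) = wedge (form1 alpha) (form1 omega)
      & ext_d D (form1 alpha) = 0].

(** * Blocks

    Blocks and their elements are numbered from 0: the j-th form of the k-th
    block is [w k j] for k < r and j < q, and the values of [w] outside this
    range are irrelevant. *)
Definition gal_act (K : fieldType) (L : splittingFieldType K) (n : nat)
    (sigma : gal_of {:L}) (a : 'rV[L]_n) : 'rV[L]_n :=
  map_mx sigma a.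

Definition block (F : fieldType) (n q : nat) (w : nat -> nat -> 'rV[F]_n)
    (k : nat) : seq 'rV[F]_n :=
  mkseq (w k) q.

Definition all_blocks (F : fieldType) (n r q : nat)
    (w : nat -> nat -> 'rV[F]_n) : seq 'rV[F]_n :=
  flatten (mkseq (block q w) r).

(** Meant for duplicate-free blocks, for which [perm_eq] is equality of sets. *)
Definition block_stabiliser (K : fieldType) (L : splittingFieldType K)
    (n r q : nat) (w : nat -> nat -> 'rV[L]_n) : {set gal_of {:L}} :=
  [set sigma in 'Gal({:L} / 1)%g |
    [forall k : 'I_r, perm_eq (map (gal_act sigma) (block q w k)) (block q w k)]].

Record block_setting (R : realType) (n : nat)
    (L : splittingFieldType (ratfun R n)) (D : 'I_n -> L -> L)
    (omega : 'rV[L]_n) (r s q : nat) (w : nat -> nat -> 'rV[L]_n)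
    (alpha : nat -> 'rV[L]_n) : Prop := BlockSetting {
  bs_first : w 0%N 0%N = omega;
  bs_uniq : uniq (all_blocks r q w);
  bs_images : forall v : 'rV[L]_n,
    v \in all_blocks r q w <->
    exists2 sigma : gal_of {:L}, sigma \in 'Gal({:L} / 1)%g & v = gal_act sigma omega;
  bs_permuted : forall sigma : gal_of {:L}, sigma \in 'Gal({:L} / 1)%g ->
    forall k, (k < r)%N ->
    exists2 l, (l < r)%N & map (gal_act sigma) (block q w k) =i block q w l;
  bs_transitive : forall k, (k < r)%N ->
    exists2 sigma : gal_of {:L}, sigma \in 'Gal({:L} / 1)%g
      & map (gal_act sigma) (block q w 0) =i block q w k;
  bs_size : (s <= q)%N;
  bs_basis : forall k, (k < r)%N ->
    basis_of <<block q w k>>%VS (mkseq (w k) s);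
  bs_sum : <<all_blocks r q w>>%VS = (\sum_(k < r) <<block q w k>>)%VS;
  bs_direct : directv (\sum_(k < r) <<block q w k>>)%VS;
  bs_bound : (r * s <= n - 1)%N;
  bs_alpha_field : forall k, (k < r)%N ->
    forall i, alpha k 0 i \in fixedField (block_stabiliser r q w);
  bs_alpha_closed : forall k, (k < r)%N -> ext_d D (form1 (alpha k)) = 0;
  bs_alpha : forall k j, (k < r)%N -> (j < q)%N ->
    ext_d D (form1 (w k j)) = wedge (form1 (alpha k)) (form1 (w k j))
}.

(** The basis w 0 0, ..., w 0 (s-1), ..., w (r-1) 0, ..., w (r-1) (s-1). *)
Definition block_basis (F : fieldType) (n r s : nat)
    (w : nat -> nat -> 'rV[F]_n) : (r * s).-tuple 'rV[F]_n :=
  [tuple w (i %/ s)%N (i %% s)%N | i < r * s].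

(** Row i holds the coordinates of the image of the i-th basis form. *)
Definition action_matrix (K : fieldType) (L : splittingFieldType K)
    (n r s : nat) (w : nat -> nat -> 'rV[L]_n) (sigma : gal_of {:L}) :
    'M[L]_(r * s) :=
  \matrix_(i, j) coord (block_basis r s w) j
                   (gal_act sigma (tnth (block_basis r s w) i)).

(* Main.v *)
Require Import Defs.
From mathcomp Require Import all_boot all_order all_algebra all_fingroup all_field.
From mathcomp Require Import reals complex.
From mathcomp Require Import mpoly.
From mathcomp Require Import ring.
From Stdlib Require Import Classical_Prop.

Set Implicit Arguments.
Unset Strict Implicit.
Unset Printing Implicit Defensive.

Import Order.TTheory GRing.Theory Num.Theory.
Local Open Scope ring_scope.

(** The image of a basis form under [sigma] is again one of the forms of some
    block l, so it satisfies the same equation d v = alpha_l /\ v as the basis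
    w_0, ..., w_(s-1) of the span of that block.  Write v = sum_j c_j w_j and
    differentiate: the terms in alpha_l cancel, and sum_j d c_j /\ w_j = 0
    remains.  By Cartan's lemma ([cartan_lemma]) each d c_j is a combination of
    the w_i, all of which are annihilated by Omega; hence d c_j /\ Omega = 0
    ([coefficients_first_integrals]).

    An element a of L with d a /\ Omega = 0 is a complex number
    ([first_integral_const]).  Differentiate p(a) = 0, where p is the minimal
    polynomial of a over K with coefficients p_k, and wedge with Omega: as
    d a /\ Omega = 0, this leaves sum_k (d p_k /\ Omega) a^k = 0, a relation
    over K of degree smaller than deg p because the leading coefficient of p is
    constant.  By minimality every d p_k /\ Omega vanishes, so every p_k is a
    complex number, there being no rational first integral; and a root of a
    complex polynomial is a complex number.

    The spans of the blocks are in direct sum, so the coordinates of v in the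
    basis of V are the c_j and zeros.  The matrix is invertible because [sigma]
    preserves the rank of the matrix whose rows are the basis forms. *)

(** * One-forms in the exterior algebra *)

(** The one-form d f. *)
Definition grad (F : comNzRingType) (n : nat) (D : 'I_n -> F -> F) (f : F) :
  'rV[F]_n := \row_i D i f.

Lemma form1_set1 (F : comNzRingType) (n : nat) (a : 'rV[F]_n) (i : 'I_n) :
  form1 a [set i] = a 0 i.
Proof.
rewrite ffunE (big_pred1 i) // => j.
by rewrite (inj_eq (@set1_inj _)) eq_sym.
Qed.

Lemma form1_eq0 (F : comNzRingType) (n : nat) (a : 'rV[F]_n) (S : {set 'I_n}) :
  (forall i, S != [set i]) -> form1 a S = 0.
Proof. by move=> h; rewrite ffunE big1 // => i /eqP e; move: (h i); rewrite e eqxx. Qed.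

Lemma form1Z (F : comNzRingType) (n : nat) (c : F) (a : 'rV[F]_n) (S : {set 'I_n}) :
  form1 (c *: a) S = c * form1 a S.
Proof. by rewrite !ffunE mulr_sumr; apply: eq_bigr => i _; rewrite mxE. Qed.

Lemma form1_sum (F : comNzRingType) (n : nat) (I : finType) (a : I -> 'rV[F]_n)
  (S : {set 'I_n}) :
  form1 (\sum_j a j) S = \sum_j form1 (a j) S.
Proof.
rewrite ffunE (eq_bigr (fun i => \sum_j a j 0 i)).
  by rewrite exchange_big; apply: eq_bigr => j _; rewrite ffunE.
by move=> i _; rewrite summxE.
Qed.

(** Only the singletons contribute to the sum over subsets that defines the
    wedge product; the right-hand side then has the same shape as the exterior
    derivative, which makes the Leibniz rule a termwise computation. *)
Lemma wedge_form1E (F : comNzRingType) (n : nat) (a : 'rV[F]_n)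
    (theta : diff_form F n) (S : {set 'I_n}) :
  wedge (form1 a) theta S =
    \sum_(i in S) wedge_sign F [set i] (S :\ i) * a 0 i * theta (S :\ i).
Proof.
rewrite ffunE (bigID (fun A : {set 'I_n} => A \in [set [set i] | i in S])) /=.
rewrite [X in _ + X]big1 ?addr0 => [|A /andP[AS nA]]; last first.
  rewrite form1_eq0 ?mulr0 ?mul0r // => i; apply: contraNneq nA => eA.
  by rewrite eA; apply: imset_f; rewrite -sub1set -eA.
rewrite (eq_bigl (fun A => A \in [set [set i] | i in S])) => [|A]; last first.
  rewrite andbC; case: imsetP => //= -[i iS ->]; by rewrite sub1set.
rewrite big_imset /=; last by move=> i j _ _; apply: set1_inj.
by apply: eq_bigr => i _; rewrite form1_set1.
Qed.

Lemma wedge_form1_0E (F : comNzRingType) (n : nat) (theta : diff_form F n)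
    (S : {set 'I_n}) : wedge (form1 0) theta S = 0.
Proof.
by rewrite wedge_form1E big1 // => i _; rewrite mxE mulr0 mul0r.
Qed.

Lemma wedge_form1D (F : comNzRingType) (n : nat) (a b : 'rV[F]_n)
    (theta : diff_form F n) (S : {set 'I_n}) :
  wedge (form1 (a + b)) theta S =
    wedge (form1 a) theta S + wedge (form1 b) theta S.
Proof.
rewrite !wedge_form1E -big_split; apply: eq_bigr => i _ /=.
by rewrite mxE mulrDr mulrDl.
Qed.

Lemma wedge_form1Z (F : comNzRingType) (n : nat) (c : F) (a : 'rV[F]_n)
    (theta : diff_form F n) (S : {set 'I_n}) :
  wedge (form1 (c *: a)) theta S = c * wedge (form1 a) theta S.
Proof.
rewrite !wedge_form1E mulr_sumr; apply: eq_bigr => i _ /=.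
by rewrite mxE !mulrA (mulrC c).
Qed.

Lemma wedge_form1_sum (F : comNzRingType) (n : nat) (I : finType) (c : I -> F)
    (a : I -> 'rV[F]_n) (theta : diff_form F n) (S : {set 'I_n}) :
  wedge (form1 (\sum_j c j *: a j)) theta S =
    \sum_j c j * wedge (form1 (a j)) theta S.
Proof.
rewrite wedge_form1E.
under [RHS]eq_bigr => j _ do rewrite wedge_form1E mulr_sumr.
rewrite exchange_big; apply: eq_bigr => i _.
rewrite summxE mulr_sumr mulr_suml; apply: eq_bigr => j _.
by rewrite mxE !mulrA (mulrC _ (c j)).
Qed.

Lemma wedge_map_form1 (F F' : comNzRingType) (n : nat) (f : {rmorphism F -> F'})
    (a : 'rV[F]_n) (theta : diff_form F n) (S : {set 'I_n}) :
  wedge (form1 (map_mx f a)) (map_form f theta) S = f (wedge (form1 a) theta S).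
Proof.
rewrite !wedge_form1E rmorph_sum; apply: eq_bigr => i _.
by rewrite !rmorphM rmorph_sign mxE ffunE.
Qed.

(** * Exterior derivatives of functions and one-forms *)

Lemma morphD0 (V : zmodType) (d : V -> V) :
  {morph d : a b / a + b} -> d 0 = 0.
Proof. by move=> dD; apply: (addrI (d 0)); rewrite -dD !addr0. Qed.

Lemma ext_d_form0 (F : comNzRingType) (n : nat) (D : 'I_n -> F -> F) (f : F) :
  (forall i, D i 0 = 0) -> ext_d D (form0 n f) = form1 (grad D f).
Proof.
move=> D0; apply/ffunP => S; rewrite !ffunE big_mkcond [RHS]big_mkcond /=.
apply: eq_bigr => i _; rewrite ffunE mxE.
case: (eqVneq S [set i]) => [->|nS].
  rewrite set11 setDv eqxx /wedge_sign.
  rewrite (_ : [set _ in _ | _] = set0) ?cards0 ?mul1r //.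
  by apply/setP => p; rewrite !inE andbF.
case: ifP => // iS; rewrite ifN ?D0 ?mulr0 //.
apply: contraNneq nS => /setP S0; apply/eqP/setP => j.
by move: (S0 j); rewrite !inE; case: eqVneq => //= ->.
Qed.

Lemma ext_d_form1Z (F : comNzRingType) (n : nat) (D : 'I_n -> F -> F)
    (derM : forall i a b, D i (a * b) = D i a * b + a * D i b)
    (c : F) (a : 'rV[F]_n) (S : {set 'I_n}) :
  ext_d D (form1 (c *: a)) S =
    wedge (form1 (grad D c)) (form1 a) S + c * ext_d D (form1 a) S.
Proof.
rewrite wedge_form1E [ext_d _ _ _]ffunE [ext_d D (form1 a) S]ffunE mulr_sumr.
rewrite -big_split; apply: eq_bigr => i _ /=.
by rewrite form1Z derM mxE mulrDr !mulrA (mulrC c).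
Qed.

Lemma ext_d_form1_sum (F : comNzRingType) (n : nat) (D : 'I_n -> F -> F)
    (D0 : forall i, D i 0 = 0) (derD : forall i, {morph D i : a b / a + b})
    (I : finType) (a : I -> 'rV[F]_n) (S : {set 'I_n}) :
  ext_d D (form1 (\sum_j a j)) S = \sum_j ext_d D (form1 (a j)) S.
Proof.
rewrite ffunE.
under [RHS]eq_bigr => j _ do rewrite ffunE.
rewrite exchange_big; apply: eq_bigr => i _.
by rewrite form1_sum (big_morph (D i) (derD i) (D0 i)) mulr_sumr.
Qed.

(** * Cartan's lemma *)

(** On a pair i < k the two signs are those of (i, k) and of the inversion
    (k, i). *)
Lemma wedge_form11 (F : comNzRingType) (n : nat) (a b : 'rV[F]_n) (i k : 'I_n) :
  (i < k)%N ->
  wedge (form1 a) (form1 b) [set i; k] = a 0 i * b 0 k - a 0 k * b 0 i.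
Proof.
move=> lik; have nik : i != k by rewrite neq_ltn lik.
have nki : k != i by rewrite eq_sym.
rewrite wedge_form1E big_setU1 ?inE //= big_set1.
have -> : [set i; k] :\ i = [set k].
  by apply/setP => j; rewrite !inE; case: (eqVneq j i) => //= ->; rewrite (negPf nik).
have -> : [set i; k] :\ k = [set i].
  apply/setP => j; rewrite !inE; case: (eqVneq j k) => //= [->|_].
    by rewrite (negPf nki).
  by rewrite orbF.
rewrite !form1_set1 /wedge_sign.
rewrite (_ : [set p in setX [set i] [set k] | _] = set0) ?cards0; last first.
  apply/setP => -[p1 p2]; rewrite !inE /=; apply/negP => /andP[/andP[/eqP-> /eqP->]].
  by rewrite ltnNge ltnW.
rewrite (_ : [set p in setX [set k] [set i] | _] = [set (k, i)]) ?cards1; last first.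
  apply/setP => -[p1 p2]; rewrite !inE /= xpair_eqE.
  by case: (eqVneq p1 k) => //= ->; case: (eqVneq p2 i) => //= ->.
by rewrite expr0 expr1 mul1r mulN1r mulNr.
Qed.

(** Read on the pairs i < k, the hypothesis says that the matrix U^T W is
    symmetric.  With P a right inverse of W, this gives
    U^T = U^T W P = W^T U P, so that U = (U P)^T W. *)
Lemma cartan_lemma (F : fieldType) (n s : nat) (U W : 'M[F]_(s, n)) :
  row_free W ->
  (forall S, \sum_i wedge (form1 (row i U)) (form1 (row i W)) S = 0) ->
  (U <= W)%MS.
Proof.
move=> /row_freeP[P WP] UW.
have sym_lt (i k : 'I_n) : (i < k)%N -> (U^T *m W) i k = (W^T *m U) i k.
  move=> lik; apply/eqP; rewrite -subr_eq0 -[X in _ == X](UW [set i; k]) !mxE -sumrB.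
  apply/eqP/eq_bigr => j _; rewrite wedge_form11 // !mxE.
  by rewrite (mulrC (U j k)).
have tr_sym : (U^T *m W)^T = W^T *m U by rewrite trmx_mul trmxK.
have sym : U^T *m W = W^T *m U.
  apply/matrixP => i k; case: (ltngtP i k) => [/sym_lt // | /sym_lt | /val_inj ->].
    by move=> h; rewrite -tr_sym [RHS]mxE h -tr_sym [RHS]mxE.
  by rewrite -tr_sym [RHS]mxE.
have -> : U = (U *m P)^T *m W.
  by rewrite -[LHS]trmxK -[U^T]mulmx1 -WP mulmxA sym -mulmxA trmx_mul trmxK.
exact: submxMl.
Qed.

Lemma row_free_of_free (F : fieldType) (n m : nat) (X : m.-tuple 'rV[F]_n) :
  free X -> row_free (\matrix_i tnth X i).
Proof.
move=> /freeP fX; apply: inj_row_free => v; rewrite mulmx_sum_row => v0.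
apply/rowP => i; rewrite [RHS]mxE; apply: (fX (v 0)).
by rewrite -[RHS]v0; apply: eq_bigr => j _; rewrite rowK (tnth_nth 0).
Qed.

(** * First integrals algebraic over the rational functions *)

(** The chain rule: the coefficients of p are differentiated too. *)
Lemma derivation_horner (F : comNzRingType) (d : F -> F)
    (dD : {morph d : a b / a + b})
    (dM : forall a b, d (a * b) = d a * b + a * d b) (p : {poly F}) (a : F) :
  d p.[a] = (map_poly d p).[a] + p^`().[a] * d a.
Proof.
have d0 : d 0 = 0 := morphD0 dD.
elim/poly_ind: p => [|p c IHp].
  by rewrite linear0 !horner0 mul0r addr0 d0 map_poly0 horner0.
have -> : map_poly d (p * 'X + c%:P) = map_poly d p * 'X + (d c)%:P.
  apply/polyP => -[|k]; rewrite coef_map_id0 // !coefD !coefMX !coefC /=.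
    by rewrite !add0r.
  by rewrite !addr0 coef_map_id0.
rewrite !hornerE dD dM IHp derivD derivM derivX derivC !hornerE.
ring.
Qed.

Lemma coef_lift_poly (F F' : nzRingType) (f : {rmorphism F -> F'}) (p : {poly F'}) :
  (forall k, exists c, p`_k = f c) -> exists q, p = map_poly f q.
Proof.
elim/poly_ind: p => [_|p c IHp pf]; first by exists 0; rewrite rmorph0.
have [|q ->] := IHp.
  by move=> k; have [e] := pf k.+1; rewrite coefD coefMX coefC addr0; exists e.
have [e] := pf 0%N; rewrite coefD coefMX coefC add0r /= => ->.
by exists (q * 'X + e%:P); rewrite rmorphD rmorphM /= map_polyX map_polyC.
Qed.

(** [p] splits into linear factors already over [C]. *)
Lemma root_in_closed_subfield (C : closedFieldType) (F : fieldType)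
    (f : {rmorphism C -> F}) (p : {poly C}) (a : F) :
  p != 0 -> root (map_poly f p) a -> exists c, a = f c.
Proof.
have [rs ep] := closed_field_poly_normal p.
rewrite -lead_coef_eq0 => lp; rewrite ep map_polyZ rootZ ?fmorph_eq0 //.
rewrite rmorph_prod /=.
under eq_bigr do rewrite map_polyXsubC.
rewrite -(big_map f predT (fun x => 'X - x%:P)) root_prod_XsubC => /mapP[c _ ->].
by exists c.
Qed.

Lemma grad_horner (F : comNzRingType) (n : nat) (D : 'I_n -> F -> F)
    (dD : forall i, {morph D i : a b / a + b})
    (dM : forall i a b, D i (a * b) = D i a * b + a * D i b)
    (p : {poly F}) (a : F) :
  grad D p.[a] =
    \sum_(k < size p) a ^+ k *: grad D p`_k + p^`().[a] *: grad D a.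
Proof.
have d0 i : D i 0 = 0 := morphD0 (dD i).
apply/rowP => i; rewrite !mxE derivation_horner // summxE; congr (_ + _).
rewrite (horner_coef_wide a (size_poly _ _)); apply: eq_bigr => k _.
by rewrite coef_map_id0 // !mxE mulrC.
Qed.

(** The nonexistence of first integrals in K extends to L, by applying it to the
    coefficients of minimal polynomials. *)
Lemma first_integral_const (R : realType) (n : nat)
    (Omega : diff_form (ratfun R n) n) (L : fieldExtType (ratfun R n))
    (D : 'I_n -> L -> L) (hD : extends_partial D)
    (hint : ~ exists phi : ratfun R n, rational_first_integral Omega phi)
    (a : L) :
  (forall S, wedge (form1 (grad D a)) (map_form (in_alg L) Omega) S = 0) ->
  exists c : R[i], a = (ratfun_const n c)%:A.
Proof.
case: hD => dD dM dbase a_int.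
have D0 i : D i 0 = 0 := morphD0 (dD i).
have D1 i : D i 1 = 0.
  by apply: (addrI (D i 1)); rewrite -{3}[1]mulr1 dM mulr1 mul1r addr0.
have grad_base c : grad D c%:A = map_mx (in_alg L) (grad (@partial R n) c).
  by apply/rowP => i; rewrite !mxE dbase.
have partial0 i : @partial R n i 0 = 0.
  by apply: (fmorph_inj (in_alg L)); rewrite /= -dbase !scale0r D0.
have /polyOver1P[p0 ep] := minPolyOver 1 a.
have p0_const k : exists c : R[i], p0`_k = ratfun_const n c.
  apply: NNPP => nc; apply: hint; exists p0`_k; split=> //.
  rewrite ext_d_form0 //; apply/ffunP => S; rewrite [RHS]ffunE.
  pose t j : ratfun R n := wedge (form1 (grad (@partial R n) p0`_j)) Omega S.
  have p0_monic : p0 \is monic.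
    by rewrite -(map_monic (in_alg L)) -ep monic_minPoly.
  (* The coefficients from the leading one on are 1 and 0. *)
  have t_top j : ((size p0).-1 <= j)%N -> t j = 0.
    rewrite leq_eqVlt => /predU1P[<-|lt_j]; rewrite /t.
      rewrite -[_`__]/(lead_coef p0) (monicP p0_monic).
      rewrite (_ : grad _ 1 = 0) ?wedge_form1_0E //.
      apply/rowP => i; rewrite !mxE; apply: (fmorph_inj (in_alg L)).
      by rewrite /= -dbase !scale1r scale0r D1.
    rewrite nth_default; last by move: lt_j; case: (size p0).
    rewrite (_ : grad _ 0 = 0) ?wedge_form1_0E //.
    by apply/rowP => i; rewrite !mxE partial0.
  (* Q is the relation left by differentiating p(a) = 0 and reading off the
     coefficient at S of the wedge product with Omega. *)
  pose Q : {poly ratfun R n} := \poly_(j < size p0) t j.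
  have QE j : Q`_j = t j.
    rewrite coef_poly; case: ltnP => // ge_j.
    by rewrite t_top // (leq_trans (leq_pred _)).
  have Q_root : root (map_poly (in_alg L) Q) a.
    have := a_int S; rewrite rootE => aS.
    have sQ : (size (map_poly (in_alg L) Q) <= size p0)%N.
      by rewrite size_map_poly size_poly.
    rewrite (horner_coef_wide a sQ).
    have gp : wedge (form1 (grad D (minPoly 1 a).[a])) (map_form (in_alg L) Omega) S = 0.
      rewrite minPolyxx (_ : grad D 0 = 0) ?wedge_form1_0E //.
      by apply/rowP => i; rewrite !mxE D0.
    move: gp; rewrite grad_horner // wedge_form1D wedge_form1Z aS mulr0 addr0.
    rewrite wedge_form1_sum ep size_map_poly => gp.
    apply/eqP; rewrite -[RHS]gp; apply: eq_bigr => j _.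
    have -> : (map_poly (in_alg L) p0)`_j = (p0`_j)%:A by rewrite coef_map.
    have -> : (map_poly (in_alg L) Q)`_j = (t j)%:A.
      by rewrite coef_map; congr (_ *: _); apply: QE.
    by rewrite grad_base wedge_map_form1 mulrC.
  rewrite -[LHS]/(t k) -QE (_ : Q = 0) ?coef0 //.
  (* A nonzero Q would be a multiple of the minimal polynomial. *)
  apply/eqP; apply: contraTT isT => Q0.
  have := minPoly_dvdp (alg_polyOver 1%AS Q) Q_root.
  move/(dvdp_leq _); rewrite map_poly_eq0 => /(_ Q0); rewrite ep !size_map_poly.
  rewrite leqNgt (leq_ltn_trans (n := (size p0).-1)) //.
    by apply/leq_sizeP => j le_j; apply: etrans (QE j) (t_top j le_j).
  by rewrite prednK // lt0n size_poly_eq0 monic_neq0.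
(* As C is algebraically closed, the roots of p in L are those it has in C. *)
have [pc epc] : exists q : {poly R[i]}, p0 = map_poly (@tofrac _ \o @mpolyC n R[i]) q.
  exact: coef_lift_poly.
apply: (@root_in_closed_subfield _ _ (in_alg L \o (@tofrac _ \o @mpolyC n R[i])) pc).
  by rewrite -(map_poly_eq0 (@tofrac _ \o @mpolyC n R[i])) -epc -(map_poly_eq0 (in_alg L)) -ep monic_neq0 ?monic_minPoly.
by rewrite map_poly_comp -epc -ep root_minPoly.
Qed.

(** * Coordinates in the bases of the blocks *)

(** Subtracting al /\ v from d v leaves sum_j d (c j) /\ X_j = 0, to which
    Cartan's lemma applies; forms annihilated by [theta] make up a subspace. *)
Lemma coefficients_first_integrals (F : fieldType) (n s : nat)
    (D : 'I_n -> F -> F) (dD : forall i, {morph D i : a b / a + b})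
    (dM : forall i a b, D i (a * b) = D i a * b + a * D i b)
    (theta : diff_form F n) (al : 'rV[F]_n) (X : s.-tuple 'rV[F]_n)
    (c : 'I_s -> F) :
  free X ->
  (forall j, ext_d D (form1 (tnth X j)) = wedge (form1 al) (form1 (tnth X j))) ->
  (forall j S, wedge (form1 (tnth X j)) theta S = 0) ->
  let v := \sum_j c j *: tnth X j in
  ext_d D (form1 v) = wedge (form1 al) (form1 v) ->
  forall j S, wedge (form1 (grad D (c j))) theta S = 0.
Proof.
move=> fX dX X0 v dv j S.
have D0 i : D i 0 = 0 := morphD0 (dD i).
pose U : 'M[F]_(s, n) := \matrix_i grad D (c i).
have /submxP[P /(congr1 (row j))] : (U <= \matrix_i tnth X i)%MS.
  apply: cartan_lemma; first exact: row_free_of_free.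
  move=> T; move/ffunP/(_ T): dv; rewrite ext_d_form1_sum // wedge_form1E.
  under eq_bigr => i _ do rewrite ext_d_form1Z // dX.
  rewrite big_split /= => /eqP.
  set t1 := \sum_i _; set t2 := \sum_i _; set t3 := \sum_(i in T) _.
  have -> : t2 = t3.
    rewrite /t2 /t3.
    under eq_bigr => i _ do rewrite wedge_form1E mulr_sumr.
    rewrite exchange_big; apply: eq_bigr => k _.
    rewrite form1_sum mulr_sumr; apply: eq_bigr => i _.
    by rewrite form1Z mulrCA.
  rewrite -subr_eq0 addrK => /eqP t10; rewrite -[RHS]t10.
  by apply: eq_bigr => i _; rewrite !rowK.
rewrite rowK row_mul mulmx_sum_row => ->.
under eq_bigr => i _ do rewrite rowK.
by rewrite wedge_form1_sum big1 // => i _; rewrite X0 mulr0.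
Qed.

Lemma mkseq_divmod (T : Type) (w : nat -> nat -> T) (r s : nat) : (0 < s)%N ->
  mkseq (fun i => w (i %/ s)%N (i %% s)%N) (r * s) =
    \big[cat/[::]]_(k < r) mkseq (w k) s.
Proof.
move=> s0; elim: r => [|r IHr]; first by rewrite big_ord0.
rewrite big_ord_recr /= -IHr mulSnr /mkseq iotaD map_cat add0n; congr (_ ++ _).
rewrite -[in LHS](addn0 (r * s)%N) iotaDl -map_comp.
apply/eq_in_map => i; rewrite mem_iota add0n => lt_i /=.
by rewrite divnMDl // modnMDl divn_small // modn_small // addn0.
Qed.

(** In this form the freeness of the basis is that of a concatenation of bases
    of spaces in direct sum. *)
Lemma block_basisE (F : fieldType) (n r s : nat) (w : nat -> nat -> 'rV[F]_n) :
  (0 < s)%N ->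
  block_basis r s w = \big[cat/[::]]_(k < r) mkseq (w k) s :> seq 'rV[F]_n.
Proof. by move=> s0; rewrite -mkseq_divmod // /mkseq -val_enum_ord -map_comp. Qed.

Lemma nth_block_basis (F : fieldType) (n r s : nat) (w : nat -> nat -> 'rV[F]_n)
    (l m : nat) : (l < r)%N -> (m < s)%N ->
  exists i : 'I_(r * s), (block_basis r s w)`_i = w l m.
Proof.
move=> lr ms.
have lt_i : (l * s + m < r * s)%N.
  by apply: (@leq_trans (l.+1 * s)%N); rewrite ?leq_mul2r ?lr ?orbT // mulSnr ltn_add2l.
exists (Ordinal lt_i); rewrite -tnth_nth tnth_mktuple /=.
by rewrite divnMDl ?(leq_ltn_trans _ ms) // modnMDl divn_small // modn_small // addn0.
Qed.

(** [Omega] has coefficients in K, which [sigma] fixes. *)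
Lemma gal_act_wedge_eq0 (K : fieldType) (n : nat) (L : splittingFieldType K)
    (Omega : diff_form K n) (sigma : gal_of {:L}) (a : 'rV[L]_n) (S : {set 'I_n}) :
  wedge (form1 a) (map_form (in_alg L) Omega) S = 0 ->
  wedge (form1 (gal_act sigma a)) (map_form (in_alg L) Omega) S = 0.
Proof.
move=> aS.
have -> : map_form (in_alg L) Omega = map_form sigma (map_form (in_alg L) Omega).
  by apply/ffunP => T; rewrite !ffunE /= linearZ /= rmorph1.
by rewrite /gal_act wedge_map_form1 aS rmorph0.
Qed.

(** * Constancy of the action matrix *)

Theorem proposition3 (R : realType) (n : nat) (Omega : diff_form (ratfun R n) n)
    (L : splittingFieldType (ratfun R n)) (D : 'I_n -> L -> L)
    (omega : 'rV[L]_n) (r s q : nat) (w : nat -> nat -> 'rV[L]_n)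
    (alpha : nat -> 'rV[L]_n)
    (hdeg : homogeneous (n - 1) Omega) (hOmega : Omega != 0)
    (hgal : galois 1 {:L})
    (hD : extends_partial D)
    (homega : inI Omega D omega)
    (hblocks : block_setting D omega r s q w alpha)
    (hs : (1 < s)%N)
    (hint : ~ exists phi : ratfun R n, rational_first_integral Omega phi)
    (sigma : gal_of {:L}) (hsigma : sigma \in 'Gal({:L} / 1)%g) :
  let A := action_matrix r s w sigma in
  let b := block_basis r s w in
  [/\ forall i, gal_act sigma (tnth b i) = \sum_j A i j *: tnth b j,
      A \in unitmx
    & forall i j, exists c : R[i], A i j = (ratfun_const n c)%:A].
Proof.
move=> A b.
have s0 : (0 < s)%N by apply: ltnW.
have [_ _ w_im perm_b _ sq basis_w _ dir_w _ _ _ dw] := hblocks.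
have w_Omega k m S : (k < r)%N -> (m < q)%N ->
    wedge (form1 (w k m)) (map_form (in_alg L) Omega) S = 0.
  move=> kr mq; have [_ [? [om0 _ _]]] := homega.
  have [|tau _ ->] := (w_im (w k m)).1.
    by apply/flatten_mapP; exists k; rewrite ?mem_iota // map_f // mem_iota.
  by apply: gal_act_wedge_eq0; rewrite om0 ffunE.
have free_b : free b.
  rewrite block_basisE //; apply: basis_free (bigcat_basis dir_w _) => k _.
  exact: basis_w.
have gal_b i : exists l m, [/\ (l < r)%N, (m < q)%N & gal_act sigma (tnth b i) = w l m].
  have lt_i : (i %/ s < r)%N by rewrite ltn_divLR.
  have [l lr /(_ (gal_act sigma (tnth b i)))] := perm_b _ hsigma _ lt_i.
  rewrite map_f; last first.
    by rewrite tnth_mktuple map_f // mem_iota (leq_trans _ sq) // ltn_pmod.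
  by case/esym/mapP=> m; rewrite mem_iota => mq ->; exists l, m.
pose X l : s.-tuple 'rV[L]_n := Tuple (introT eqP (size_mkseq (w l) s)).
have tnthX l j : tnth (X l) j = w l j by rewrite (tnth_nth 0) nth_mkseq.
have wE l m : (l < r)%N -> (m < q)%N ->
    w l m = \sum_j coord (X l) j (w l m) *: tnth (X l) j.
  move=> lr mq; rewrite {1}(coord_span (X := X l) (v := w l m)).
    by apply: eq_bigr => j _; rewrite (tnth_nth 0).
  rewrite (span_basis (basis_w l lr)); apply: memv_span.
  by rewrite map_f // mem_iota.
have b_span l m : (l < r)%N -> (m < q)%N -> w l m \in <<b>>%VS.
  move=> lr mq; rewrite wE //; apply: memv_suml => j _; apply: memvZ.
  have [i0] := nth_block_basis w lr (ltn_ord j).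
  by rewrite tnthX => <-; apply: memv_span; rewrite mem_nth ?size_tuple.
have act i : gal_act sigma (tnth b i) = \sum_j A i j *: tnth b j.
  have [l [m [lr mq e]]] := gal_b i.
  rewrite [LHS](@coord_span _ _ _ b) ?e ?b_span //.
  by apply: eq_bigr => j _; rewrite mxE e (tnth_nth 0).
split=> // [|i j].
  have Ab : map_mx sigma (\matrix_i tnth b i) = A *m \matrix_i tnth b i.
    apply/row_matrixP => i; rewrite row_mul mulmx_sum_row -map_row rowK.
    by rewrite [LHS]act; apply: eq_bigr => j _; rewrite rowK [row i A 0 j]mxE.
  have rk_b : \rank (A *m \matrix_i tnth b i) = (r * s)%N.
    by rewrite -Ab mxrank_map; apply/eqP/row_free_of_free.
  by rewrite -row_free_unit -row_leq_rank -[leqLHS]rk_b mxrankM_maxl.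
have [l [m [lr mq e]]] := gal_b i.
have const_c k : exists c : R[i],
    coord (X l) k (w l m) = (ratfun_const n c)%:A.
  apply: (first_integral_const hD hint).
  case: (hD) => dD dM _.
  apply: (coefficients_first_integrals dD dM (al := alpha l) (X := (X l))
    (c := fun k => coord (X l) k (w l m))).
  - exact: basis_free (basis_w l lr).
  - by move=> k'; rewrite tnthX dw // (leq_trans _ sq).
  - by move=> k' S; rewrite tnthX w_Omega // (leq_trans _ sq).
  - by rewrite -wE // dw.
rewrite mxE e wE // linear_sum.
pose f : {rmorphism R[i] -> L} := in_alg L \o (@tofrac _ \o @mpolyC n R[i]).
have [c fc] : exists c, forall k, coord (X l) k (w l m) = f (c k).
  exact: (fin_all_exists (P := fun k z => coord (X l) k (w l m) = f z)).
(* A basis form of block l belongs to the basis of V: these are 0 or 1. *)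
have [d fd] : exists d, forall k : 'I_s,
    coord b j (tnth (X l) k) = f (d k).
  apply: (fin_all_exists (P := fun k z => coord b j (tnth (X l) k) = f z)) => k.
  have [k' ] := nth_block_basis w lr (ltn_ord k).
  rewrite tnthX => <-; rewrite coord_free //; exists (k' == j)%:R.
  by rewrite rmorph_nat.
exists (\sum_k c k * d k).
rewrite -[RHS]/(f _) rmorph_sum; apply: eq_bigr => k _.
by rewrite linearZ fc [RHS]rmorphM; congr (_ * _); apply: fd.
Qed.
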